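(* Let $d>3$ be an integer. Then $d$ is HS-prime partitionable if and only if $d$ is TE-prime partitionable (both notions as defined in the context below).
   Context: An integer $n$ is called HS-prime partitionable if there is a partition $\{\mathbb{P}_1,\mathbb{P}_2\}$ of the set of all primes less than $n$ into two nonempty disjoint sets such that for all positive integers $n_1,n_2$ with $n_1+n_2=n$ there is some pair $(p_1,p_2)\in\mathbb{P}_1\times\mathbb{P}_2$ with $\gcd(n_1,p_1)>1$ or $\gcd(n_2,p_2)>1$. An integer $d$ is called TE-prime partitionable if there exist positive integers $n_1,n_2$ with $d=\gcd(n_1,n_2)$ such that for every pair of positive integers $d_1,d_2$ with $d_1+d_2=d$, either $\gcd(n_1,d_1)\neq 1$ or $\gcd(n_2,d_2)\neq 1$. *)

(* Defs.v *)
From mathcomp Require Import all_boot.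

Set Implicit Arguments.
Unset Strict Implicit.
Unset Printing Implicit Defensive.

Definition primes_below (n : nat) : {set 'I_n} := [set p : 'I_n | prime p].

(* Both notions are defined on nat: neither can hold of a negative integer
   (no primes below it; not a gcd of positive integers). *)
Definition HS_prime_partitionable (n : nat) : Prop :=
  exists P1 P2 : {set 'I_n},
    [/\ P1 != set0, P2 != set0, [disjoint P1 & P2],
        P1 :|: P2 = primes_below n
      & forall n1 n2 : nat, 0 < n1 -> 0 < n2 -> n1 + n2 = n ->
          exists p1 p2 : 'I_n,
            [/\ p1 \in P1, p2 \in P2
              & 1 < gcdn n1 p1 \/ 1 < gcdn n2 p2]].

Definition TE_prime_partitionable (d : nat) : Prop :=
  exists n1 n2 : nat,
    [/\ 0 < n1, 0 < n2, d = gcdn n1 n2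
      & forall d1 d2 : nat, 0 < d1 -> 0 < d2 -> d1 + d2 = d ->
          gcdn n1 d1 <> 1 \/ gcdn n2 d2 <> 1].

(* Main.v *)
Require Import Defs.
From mathcomp Require Import all_boot.

(** From a partition, multiply [d] by the product of the primes in each part:
    the two products are coprime, so the gcd stays [d].  Conversely, put in the
    first part the primes below [d] that divide [n1], and all others in the
    second.  A prime dividing both [n1] and [n2] divides [d], hence divides [d1]
    as soon as it divides [d2], so it may be placed on either side.  The
    decompositions [(d - 1) + 1] and [1 + (d - 1)] show that neither part is
    empty. *)

(** Positivity of [n] excludes a zero gcd, so a gcd other than 1 exceeds 1 and its least prime
    divisor serves. *)
Lemma gcdn_neq1_prime m n : 0 < n -> gcdn m n <> 1 ->
  exists p, [/\ prime p, p %| m & p %| n].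
Proof.
move=> n_gt0 neq1; exists (pdiv (gcdn m n)).
have gt1 : 1 < gcdn m n by rewrite ltn_neqAle eq_sym gcdn_gt0 n_gt0 orbT andbT; apply/eqP.
by split; [exact: pdiv_prime | |]; apply: dvdn_trans (pdiv_dvd _) _;
  rewrite ?dvdn_gcdl ?dvdn_gcdr.
Qed.

Lemma prime_gcdn_gt1 m p : prime p -> (1 < gcdn m p) = (p %| m).
Proof.
move=> p_pr; rewrite -[RHS]negbK -prime_coprime // coprime_sym /coprime.
by rewrite ltn_neqAle eq_sym gcdn_gt0 (prime_gt0 p_pr) orbT andbT.
Qed.

Lemma dvdn_gcdn_neq1 p m n : prime p -> p %| m -> p %| n -> gcdn m n <> 1.
Proof.
move=> p_pr pm pn eq1; have : p %| gcdn m n by rewrite dvdn_gcd pm.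
by rewrite eq1 Euclid_dvd1.
Qed.

Lemma coprime_prodr (I : finType) (A : {pred I}) (F : I -> nat) m :
  (forall i, i \in A -> coprime m (F i)) -> coprime m (\prod_(i in A) F i).
Proof.
move=> co; apply: (big_ind (coprime m)) => //; first exact: coprimen1.
by move=> x y cx cy; rewrite coprimeMr cx.
Qed.

(** Distinct primes are coprime, and disjointness keeps every factor of one product distinct from
    every factor of the other. *)
Lemma coprime_prod_primes n (A B : {set 'I_n}) :
    A \subset primes_below n -> B \subset primes_below n -> [disjoint A & B] ->
  coprime (\prod_(p in A) p) (\prod_(q in B) q).
Proof.
move=> /subsetP sA /subsetP sB dAB.
rewrite coprime_sym; apply: coprime_prodr => p pA; rewrite coprime_sym.
apply: coprime_prodr => q qB.
have := sA p pA; have := sB q qB; rewrite !inE => q_pr p_pr.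
rewrite prime_coprime // dvdn_prime2 //; apply: contraTneq qB => /val_inj <-.
by rewrite (disjointFr dAB).
Qed.

Lemma HS_TE d : 0 < d -> HS_prime_partitionable d -> TE_prime_partitionable d.
Proof.
move=> d_gt0 [P1 [P2 [_ _ dP eqP12 part]]].
have s1 : P1 \subset primes_below d by rewrite -eqP12 subsetUl.
have s2 : P2 \subset primes_below d by rewrite -eqP12 subsetUr.
have prod_gt0 (A : {set 'I_d}) : A \subset primes_below d -> 0 < \prod_(p in A) p.
  by move=> /subsetP sA; apply: prodn_cond_gt0 => p /sA; rewrite inE => /prime_gt0.
exists (d * \prod_(p in P1) p), (d * \prod_(p in P2) p).
split; rewrite ?muln_gt0 ?d_gt0 ?prod_gt0 //.
  by rewrite -muln_gcdr (eqP (coprime_prod_primes _ _ _ s1 s2 dP)) muln1.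
move=> d1 d2 d1_gt0 d2_gt0 /(part _ _ d1_gt0 d2_gt0) [p1 [p2 [p1P p2P]]].
have := subsetP s1 _ p1P; have := subsetP s2 _ p2P; rewrite !inE => pr2 pr1.
(* The chosen prime is a factor of the product over its own part, so it divides the matching witness
   as well as the summand. *)
rewrite !prime_gcdn_gt1 //; case=> p_dvd; [left | right];
  apply: dvdn_gcdn_neq1 _ p_dvd => //; apply: dvdn_mull.
  by rewrite (bigD1 p1) //= dvdn_mulr.
by rewrite (bigD1 p2) //= dvdn_mulr.
Qed.

Lemma TE_HS d : 1 < d -> TE_prime_partitionable d -> HS_prime_partitionable d.
Proof.
move=> d_gt1 [n1 [n2 [n1_gt0 n2_gt0 d_gcd witness]]].
pose P1 := [set p in primes_below d | p %| n1].
pose P2 := [set p in primes_below d | ~~ (p %| n1)].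
(* Only the prime that divides a summand is sought here. Its partner in the pair may be any element
   of the other part, once both parts are known to be inhabited. *)
have key d1 d2 : 0 < d1 -> 0 < d2 -> d1 + d2 = d ->
    (exists2 p, p \in P1 & p %| d1) \/ (exists2 p, p \in P2 & p %| d2).
  move=> d1_gt0 d2_gt0 d12.
  (* Each summand is smaller than [d] because the other is positive, so its prime divisors are
     elements of ['I_d]. *)
  have lt1 p : p %| d1 -> p < d.
    by move=> /(dvdn_leq d1_gt0) /leq_ltn_trans; apply; rewrite -d12 -{1}[d1]addn0 ltn_add2l.
  have lt2 p : p %| d2 -> p < d.
    by move=> /(dvdn_leq d2_gt0) /leq_ltn_trans; apply; rewrite -d12 -{1}[d2]add0n ltn_add2r.
  case: (witness d1 d2 d1_gt0 d2_gt0 d12) => /gcdn_neq1_prime [] // p [p_pr pn pd].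
    by left; exists (Ordinal (lt1 p pd)); rewrite ?inE ?p_pr.
  have [pn1 | pNn1] := boolP (p %| n1); last first.
    by right; exists (Ordinal (lt2 p pd)); rewrite ?inE ?p_pr.
  have pd1 : p %| d1 by rewrite -(dvdn_addl _ pd) d12 d_gcd dvdn_gcd pn1.
  by left; exists (Ordinal (lt1 p pd1)); rewrite ?inE ?p_pr.
have pred_gt0 : 0 < d.-1 by rewrite -subn1 subn_gt0.
have predK : d.-1.+1 = d by rewrite prednK // ltnW.
(* When one summand is 1, this forces the prime given by [key] into the part that faces [d.-1]. *)
have dvd1F (A : {set 'I_d}) p : A \subset primes_below d -> p \in A -> p %| 1 -> False.
  by move=> /subsetP sA /sA; rewrite inE => /Euclid_dvd1 ->.
have s1 : P1 \subset primes_below d by apply/subsetP => p; rewrite inE => /andP[].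
have s2 : P2 \subset primes_below d by apply/subsetP => p; rewrite inE => /andP[].
have [p1 p1P] : exists p, p \in P1.
  case: (key d.-1 1) => //; first by rewrite addn1.
    by case=> p pP _; exists p.
  by case=> p pP /(dvd1F _ _ s2 pP).
have [p2 p2P] : exists p, p \in P2.
  case: (key 1 d.-1) => //; first by case=> p pP /(dvd1F _ _ s1 pP).
  by case=> p pP _; exists p.
exists P1, P2; split; first by apply/set0Pn; exists p1.
- by apply/set0Pn; exists p2.
- rewrite -setI_eq0; apply/eqP/setP => p; rewrite !inE.
  by case: (p %| n1); rewrite ?andbF.
- by apply/setP => p; rewrite !inE -andb_orr orbN andbT.
move=> d1 d2 d1_gt0 d2_gt0 /(key _ _ d1_gt0 d2_gt0) [] [p pP pd].
  exists p, p2; split=> //; left.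
  by rewrite prime_gcdn_gt1 //; have := subsetP s1 _ pP; rewrite inE.
exists p1, p; split=> //; right.
by rewrite prime_gcdn_gt1 //; have := subsetP s2 _ pP; rewrite inE.
Qed.

Theorem theorem1 (d : nat) (hd : 3 < d) :
  HS_prime_partitionable d <-> TE_prime_partitionable d.
Proof.
by split; [apply: HS_TE | apply: TE_HS]; apply: leq_trans hd.
Qed.
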